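(* Let $G=[g_1,g_2,\ldots]$ be an abelian transcendental semigroup. Then the escaping set $I(G)$ is backward invariant under $G$, i.e. $g^{-1}(I(G))\subset I(G)$ for all $g\in G$.
   Context: A transcendental semigroup $G=[g_1,g_2,\ldots]$ is the semigroup, under functional composition, generated by a family $\{g_1,g_2,\ldots\}$ of transcendental entire functions $\mathbb{C}\to\mathbb{C}$. It is called abelian if $g_i\circ g_j=g_j\circ g_i$ for all $i,j$. The escaping set of $G$ is $I(G)=\{z\in\mathbb{C} : \text{every sequence of distinct elements of } G \text{ has a subsequence which diverges to infinity at } z\}$, i.e. for every sequence $(f_n)$ of pairwise distinct elements of $G$ there is a subsequence $(f_{n_k})$ with $f_{n_k}(z)\to\infty$. For $W\subset\mathbb{C}$, $g^{-1}(W)=\{w\in\mathbb{C}: g(w)\in W\}$. *)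

(* Defs.v *)
From mathcomp Require Import all_boot all_order all_algebra.
From mathcomp Require Import complex.
From mathcomp Require Import all_classical all_reals all_analysis.

Set Implicit Arguments.
Unset Strict Implicit.
Unset Printing Implicit Defensive.

Import Order.TTheory GRing.Theory Num.Theory.
Import numFieldNormedType.Exports.

Local Open Scope classical_set_scope.
Local Open Scope ring_scope.
Local Open Scope complex_scope.

(* [R[i]^o] is [R[i]] as a normed space over itself, so that [derivable] in the
   direction 1 is differentiability with respect to the complex variable. *)
Definition entire (R : realType) (f : R[i] -> R[i]) : Prop :=
  forall z : R[i], derivable (f : R[i]^o -> R[i]^o) z 1.

Definition transcendental_entire (R : realType) (f : R[i] -> R[i]) : Prop :=
  entire f /\ ~ exists p : {poly R[i]}, forall z : R[i], f z = p.[z].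

(* A finite nonempty list of generators is the case of a family [g] with
   repetitions. *)
Inductive semigroup_gen (T : Type) (g : nat -> T -> T) : set (T -> T) :=
| semigroup_gen_base (i : nat) : semigroup_gen g (g i)
| semigroup_gen_comp (f h : T -> T) :
    semigroup_gen g f -> semigroup_gen g h -> semigroup_gen g (f \o h).

Definition abelian_family (T : Type) (g : nat -> T -> T) : Prop :=
  forall i j : nat, g i \o g j = g j \o g i.

(* The norm of [R[i]] takes its values in [R[i]], where [+oo] is the filter
   generated by the sets [[set x | M < x]] with [M] real. *)
Definition diverges_to_infinity (R : realType) (u : nat -> R[i]) : Prop :=
  `|u k| @[k --> \oo] --> +oo.

Definition escaping_set (R : realType) (G : set (R[i] -> R[i])) : set R[i] :=
  [set z | forall f : nat -> R[i] -> R[i],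
     (forall n : nat, G (f n)) -> injective f ->
     exists2 k : nat -> nat, {homo k : m n / (m < n)%N} &
       diverges_to_infinity (fun n => f (k n) z)].

Definition backward_invariant (T : Type) (G : set (T -> T)) (W : set T) : Prop :=
  forall g : T -> T, G g -> g @^-1` W `<=` W.

(* Main.v *)
Require Import Defs.
From mathcomp Require Import all_boot all_order all_algebra.
From mathcomp Require Import complex.
From mathcomp Require Import all_classical all_reals all_analysis.

(** If [g z] lies in [I(G)] and [(f n)] is a sequence of distinct elements of
    [G], some subsequence of [f n (g z) = g (f n z)] tends to infinity; as the
    continuous map [g] is bounded on bounded sets, [f n z] must tend to infinity
    along that subsequence too. *)

Import Order.TTheory GRing.Theory Num.Theory.
Import numFieldNormedType.Exports.

Local Open Scope classical_set_scope.
Local Open Scope ring_scope.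
Local Open Scope complex_scope.

Lemma normc_le_ReIm (R : realType) (z : R[i]) :
  `|z| <= (`|complex.Re z| + `|complex.Im z|)%:C.
Proof.
rewrite normc_def lecR -[leRHS]ger0_norm ?addr_ge0// -sqrtr_sqr ler_wsqrtr//.
by rewrite sqrrD !real_normK ?num_real// lerD2r lerDl mulrn_wge0// mulr_ge0.
Qed.

Lemma normr_Im_le (R : realType) (z : R[i]) : `|complex.Im z|%:C <= `|z|.
Proof. by rewrite normc_def lecR -sqrtr_sqr ler_wsqrtr// lerDr sqr_ge0. Qed.

Lemma continuous_complex_of_pair (R : realType) :
  continuous ((fun p => p.1 +i* p.2) : R * R -> R[i]^o).
Proof.
move=> p; apply/cvgrPdist_lt => e e0.
(* The radius [e] lives in [R[i]]; being positive it is real, so half of its real part can serve as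
   a tolerance for each coordinate. *)
have eE : e = (complex.Re e)%:C by rewrite RRe_real// gtr0_real.
have e20 : 0 < complex.Re e / 2 by rewrite divr_gt0// -ltcR -eE.
have /cvgrPdist_lt/(_ _ e20) near1 : (fun q : R * R => q.1) @ p --> p.1.
  exact: cvg_fst.
have /cvgrPdist_lt/(_ _ e20) near2 : (fun q : R * R => q.2) @ p --> p.2.
  exact: cvg_snd.
near=> q; rewrite eE.
apply: le_lt_trans (@normc_le_ReIm R ((p.1 +i* p.2) - (q.1 +i* q.2))) _.
rewrite ltcR [ltRHS]splitr; apply: ltrD => /=.
  by near: q; exact: near1.
by near: q; exact: near2.
Unshelve. all: by end_near. Qed.

Lemma continuous_Re_normc (R : realType) :
  continuous ((fun z => complex.Re `|z|) : R[i]^o -> R).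
Proof.
move=> z; apply/(@cvgrPdist_lt _ _ _ (nbhs (z : R[i]^o)) (nbhs_filter _)) => e e0.
exists e%:C => /= [|w zw]; first by rewrite ltcR.
rewrite -ltcR; apply: le_lt_trans zw.
(* Reverse triangle inequality; both norms are real, so it descends to their real parts. *)
apply: le_trans (ler_dist_dist z w).
rewrite -[in leRHS](RRe_real (normr_real z)) -[in leRHS](RRe_real (normr_real w)).
by rewrite -rmorphB normc_def /= expr0n addr0 sqrtr_sqr.
Qed.

(** The disc of radius [M] sits inside a compact square of [R * R], on which the extreme value
    theorem applies to the modulus of [f], made real-valued by taking [complex.Re]. *)
Lemma entire_bounded (R : realType) (f : R[i] -> R[i]) (M : R) : entire f ->
  exists B : R, forall z, `|z| <= M%:C -> `|f z| <= B%:C.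
Proof.
move=> df; have [M0|M0] := leP 0 M; last first.
  (* For negative [M] the disc is empty and any bound will do. *)
  exists 0 => z zM; have := le_trans (normr_ge0 z) zM.
  by rewrite lecR leNgt M0.
pose K : set (R * R) := `[- M, M] `*` `[- M, M].
pose h (p : R * R) : R := complex.Re `|f (p.1 +i* p.2)|.
have hc : continuous h.
  move=> p.
  apply: (@continuous_comp _ _ _ (fun p : R * R => f (p.1 +i* p.2) : R[i]^o)
    ((fun z => complex.Re `|z|) : R[i]^o -> R)); last exact: continuous_Re_normc.
  apply: (@continuous_comp _ _ _ ((fun p => p.1 +i* p.2) : R * R -> R[i]^o)
    (f : R[i]^o -> R[i]^o)); first exact: continuous_complex_of_pair.
  exact/differentiable_continuous/derivable1_diffP/df.
have M00 : K !=set0 by exists (0, 0); split; rewrite /= in_itv/= oppr_le0 M0.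
have Kc : compact K by apply: compact_setX; exact: segment_compact.
have [c _ hmax] := compact_EVT_max M00 Kc (continuous_subspaceT hc).
exists (h c) => -[a b] zM.
have : h (a, b) <= h c.
  apply: hmax; rewrite inE; split; rewrite /= in_itv/= -ler_norml -lecR.
    exact: le_trans (normc_ge_Re (a +i* b)) zM.
  exact: le_trans (normr_Im_le _ (a +i* b)) zM.
by rewrite -lecR {1}/h RRe_real ?normr_real.
Qed.

Lemma diverges_of_entire_image (R : realType) (f : R[i] -> R[i]) (u : nat -> R[i]) :
  entire f -> diverges_to_infinity (fun n => f (u n)) -> diverges_to_infinity u.
Proof.
move=> df fu A /= [M [Mreal MA]].
have [B hB] := entire_bounded _ _ (complex.Re M) df.
have Boo : \forall x \near (+oo : set_system R[i]), B%:C < x.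
  by exists B%:C; split => //; rewrite complex_real.
have {Boo}fuB : \forall n \near \oo, B%:C < `|f (u n)| := fu _ Boo.
suff : \forall n \near \oo, A `|u n| by [].
(* Once the image exceeds [B], [u n] cannot lie in the disc of radius [M]. The order of [R[i]] is
   partial: turning this into a strict inequality uses that both sides are real. *)
apply: filterS fuB => n Bn; apply: MA; rewrite -(RRe_real Mreal).
rewrite real_ltNge ?normr_real ?complex_real//; apply/negP => /hB/le_gtF.
by rewrite Bn.
Qed.

Lemma semigroup_gen_commute (T : Type) (g : nat -> T -> T) (f : T -> T) (i : nat) :
  abelian_family g -> semigroup_gen g f -> f \o g i = g i \o f.
Proof.
move=> gC; elim=> [j|f1 f2 _ IH1 _ IH2]; first exact: gC.
by rewrite -compA IH2 compA IH1.
Qed.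

Theorem theorem2p1 (R : realType) (g : nat -> R[i] -> R[i])
    (g_transcendental : forall i : nat, transcendental_entire (g i))
    (g_abelian : abelian_family g) :
  backward_invariant (semigroup_gen g) (escaping_set (semigroup_gen g)).
Proof.
(* Backward invariance passes to composites by pulling back through [f1], then [f2], so [h] may be
   taken to be a generator, which is entire by hypothesis. *)
move=> h; elim=> [i|f1 f2 _ IH1 _ IH2] z /= Iz; last exact/IH2/IH1.
move=> f Gf finj; have [k kmono kdiv] := Iz f Gf finj; exists k => //.
apply: (@diverges_of_entire_image R (g i)); first by have [] := g_transcendental i.
rewrite (_ : (fun n => _) = fun n => f (k n) (g i z))//.
apply/funext => n.
exact: (congr1 (@^~ z) (esym (semigroup_gen_commute _ _ _ i g_abelian (Gf (k n))))).
Qed.
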